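(* Let $(X,\rho,\mu)$ be a space of homogeneous type with doubling constant $C_d$ and $\mu(X)=\infty$. Let $1<p<\infty$ and let $A$ be a Young function (not assumed to be doubling) such that $A(t)/t$ is increasing, $A(t)\to\infty$ as $t\to\infty$, and $A(1)=1$. Then $M_A$ is bounded on $L^p(X,\mu)$ (that is, there is a constant $c$ such that $\|M_Af\|_{L^p}\le c\|f\|_{L^p}$ for all nonnegative $f$) if and only if $A\in B_p$.
   Context: A space of homogeneous type $(X,\rho,\mu)$ is a set $X$ with a quasimetric $\rho$ and a positive measure $\mu$ (for which the balls $B(x,r)$ of $\rho$ are measurable) that is doubling: $0<\mu(B(x_0,2r))\le C_d\,\mu(B(x_0,r))<\infty$ for all $x_0\in X$, $r>0$. A Young function is a convex, increasing, continuous function $A:[0,\infty)\to[0,\infty)$ with $A(0)=0$. It is called doubling if $A(2t)\le CA(t)$ for all $t$ and a fixed constant $C$. For a set $E$ with $\mu(E)>0$, $\|f\|_{A,E}=\inf\left\{\lambda>0:\frac1{\mu(E)}\int_EA\left(\frac{|f(x)|}{\lambda}\right)d\mu\le1\right\}$. The Orlicz maximal function is $M_Af(x)=\sup_{B\ni x}\|f\|_{A,B}$, where the supremum is over all balls $B$ containing $x$. $A\in B_p$ means that $\int_c^\infty\frac{A(t)}{t^p}\frac{dt}{t}<\infty$ for some $c>0$. *)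

(* Defs.v *)
From HB Require Import structures.
From mathcomp Require Import all_boot all_order all_algebra.
From mathcomp Require Import all_classical all_reals all_analysis.

Set Implicit Arguments.
Unset Strict Implicit.
Unset Printing Implicit Defensive.

Import Order.TTheory GRing.Theory Num.Theory.
Import numFieldNormedType.Exports.

Local Open Scope classical_set_scope.
Local Open Scope ring_scope.

Definition quasimetric (R : realType) (X : Type) (rho : X -> X -> R) : Prop :=
  [/\ forall x y, 0 <= rho x y,
      forall x y, rho x y = 0 <-> x = y,
      forall x y, rho x y = rho y x &
      exists2 K : R, 1 <= K &
        forall x y z, rho x z <= K * (rho x y + rho y z)].

Definition qball (R : realType) (X : Type) (rho : X -> X -> R) (x : X) (r : R)
    : set X :=
  [set y | rho x y < r].

Definition doubling_measure (R : realType) (d : measure_display)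
    (X : measurableType d) (rho : X -> X -> R)
    (mu : {measure set X -> \bar R}) (Cd : R) : Prop :=
  forall (x : X) (r : R), 0 < r ->
    [/\ (0 < mu (qball rho x (2 * r)))%E,
        (mu (qball rho x (2 * r)) <= Cd%:E * mu (qball rho x r))%E &
        (Cd%:E * mu (qball rho x r) < +oo)%E].

Definition homogeneous_type (R : realType) (d : measure_display)
    (X : measurableType d) (rho : X -> X -> R)
    (mu : {measure set X -> \bar R}) (Cd : R) : Prop :=
  [/\ quasimetric rho,
      forall x r, measurable (qball rho x r) &
      doubling_measure rho mu Cd].

(* Only the values of [A] on [0, +oo[ are relevant, here and below.
   "Increasing" is read in the wide sense, so that, e.g., A t = t and
   functions vanishing near 0 are allowed. *)
Definition young_function (R : realType) (A : R -> R) : Prop :=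
  [/\ convex_function (E := R^o) [set` `[0, +oo[%R] A,
      forall s t : R, 0 <= s -> s <= t -> A s <= A t,
      {within [set` `[0, +oo[%R], continuous A},
      forall t : R, 0 <= t -> 0 <= A t &
      A 0 = 0].

(* The infimum is taken in \bar R: it is +oo when no [l] is admissible, which
   can happen for f in L^p since [A] need not be doubling. *)
Definition orlicz_norm (R : realType) (d : measure_display)
    (X : measurableType d) (mu : {measure set X -> \bar R}) (A : R -> R)
    (E : set X) (f : X -> R) : \bar R :=
  ereal_inf [set l%:E | l in [set l : R | 0 < l /\
    ((mu E)^-1 * \int[mu]_(x in E) (A (`|f x| / l))%:E <= 1)%E]].

(* A ball is given by its centre [b.1] and its radius [b.2]. *)
Definition orlicz_maximal (R : realType) (d : measure_display)
    (X : measurableType d) (rho : X -> X -> R)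
    (mu : {measure set X -> \bar R}) (A : R -> R) (f : X -> R) (x : X)
    : \bar R :=
  ereal_sup [set orlicz_norm mu A (qball rho b.1 b.2) f |
    b in [set b : X * R | 0 < b.2 /\ qball rho b.1 b.2 x]].

(* If ||f||_p = +oo the inequality holds trivially since c > 0. [T f] is not
   assumed measurable: for a nonnegative function the library's integral is in
   general the supremum of the integrals of the simple functions below it. *)
Definition bounded_on_Lp (R : realType) (d : measure_display)
    (X : measurableType d) (mu : {measure set X -> \bar R}) (p : R)
    (T : (X -> R) -> X -> \bar R) : Prop :=
  exists2 c : R, 0 < c &
    forall f : X -> R, measurable_fun setT f -> (forall x, 0 <= f x) ->
      ('N[mu]_(p%:E)[T f] <= c%:E * 'N[mu]_(p%:E)[EFin \o f])%E.

Definition in_Bp (R : realType) (A : R -> R) (p : R) : Prop :=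
  exists2 c : R, 0 < c &
    (\int[@lebesgue_measure R]_(t in [set` `[c, +oo[%R])
       (A t / t `^ p / t)%:E < +oo)%E.

(* Main.v *)
Require Import Defs.
From HB Require Import structures.
From mathcomp Require Import all_boot all_order all_algebra.
From mathcomp Require Import all_classical all_reals all_analysis.
From mathcomp Require Import finmap measurable_realfun zify ring lra.
Import Order.TTheory GRing.Theory Num.Theory.
Import numFieldNormedType.Exports.
Local Open Scope classical_set_scope.
Local Open Scope ring_scope.

(* Everything is discretised at dyadic scales: A is in B_p iff
   sum_j A (c 2^j) / (2^j)^p is finite for some c.
   If A is in B_p: A (1/2) <= 1/2 shows that a ball B with ||f||_{A,B} > t
   satisfies mu B <= \int_B 2 h_t, where h_t = A (f / t) on {f > t/2} and 0
   elsewhere, so a Vitali covering gives mu {M_A f > t} <= C \int h_t. Summing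
   over t = s 2^k with weights t^p, the integrand sum_k t^p h_t is at most a
   constant times f^p. As M_A f need not be measurable, the weak-type estimate
   is applied to the level sets of the simple functions below (M_A f)^p.
   Conversely, test on the indicator of B_0 = B (x0, 1): if a larger concentric
   ball B has mu B < A (2^(j+1)) mu B_0, then M_A f >= 2^-(j+1) on B. As mu is
   doubling and mu X = +oo, B can be chosen with mu B >= A (2^(j+1)) mu B_0 / Cd,
   and \int (M_A f)^p controls sum_j 2^(-jp) mu B up to a constant. *)

(** * Vitali covering in a doubling quasimetric space *)

(* Zorn's lemma on the disjoint subfamilies S such that every member of F meeting
   S meets one of at least half its radius: a member of F disjoint from a maximal
   S, of nearly largest radius among those, could be added to S. *)
Lemma vitali_selection (R : realType) (I X : Type) (F : set I) (U : I -> set X)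
    (rad : I -> R) (M : R) :
  (forall b, F b -> 0 < rad b <= M) -> (forall b, F b -> U b !=set0) ->
  exists S : set I, [/\ S `<=` F, trivIset S U &
    forall b, F b -> exists b', [/\ S b', U b `&` U b' !=set0 &
      rad b <= 2 * rad b']].
Proof.
move=> radF U0.
pose meets b b' := U b `&` U b' !=set0.
pose P (S : set I) := [/\ S `<=` F, trivIset S U & forall b, F b ->
  (exists b', S b' /\ meets b b') ->
  exists b', [/\ S b', meets b b' & rad b <= 2 * rad b']].
have [C CP totC|S [[SF tS PS] maxS]] := @Zorn_bigcup I P.
  split.
  - by move=> b [S /CP[SF _ _]]; exact: SF.
  - move=> b b' [S CS Sb] [S' CS' Sb'].
    by have [SS'|S'S] := totC _ _ CS CS';
      [have [_ + _] := CP _ CS'; apply => //; exact: SS'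
      |have [_ + _] := CP _ CS; apply => //; exact: S'S].
  - move=> b Fb [b' [[S CS Sb'] bb']].
    have [_ _ /(_ b Fb)[|b'' [Sb'' bb'' rb]]] := CP _ CS; first by exists b'.
    by exists b''; split => //; exists S.
exists S; split => // b Fb; apply: (PS) => //.
pose G := [set b | F b /\ forall b', S b' -> ~ meets b b'].
apply: contrapT => nb.
have Gb : G b by split => // b' Sb' bb'; apply: nb; exists b'.
have radG : has_sup [set rad b | b in G].
  split; first by exists (rad b), b.
  by exists M => _ [b' [/radF/andP[]] _ ? _ <-].
have s0 : 0 < sup [set rad b | b in G].
  rewrite (@lt_le_trans _ _ (rad b))//; first by case/andP: (radF _ Fb).
  by apply: ub_le_sup; [exact: radG.2|exists b].
have [_ [b1 [Fb1 Sb1] <-] rb1] := sup_adherent (divr_gt0 s0 (ltr0Sn R 1)) radG.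
have {}rb1 b' : G b' -> rad b' <= 2 * rad b1.
  move=> Gb'; apply: (@le_trans _ _ (sup [set rad b | b in G])); last by lra.
  by apply: ub_le_sup; [exact: radG.2|exists b'].
(* Since [U b1] is nonempty, [b1] meets itself and so lies outside [S]: adding it is a strict
   enlargement. *)
have b11 : meets b1 b1 by rewrite /meets setIid; exact: U0.
apply: (maxS (S `|` [set b1])).
  split; first exact: subsetUl.
  by move=> /(_ b1)/(_ (or_intror erefl))/Sb1; apply.
split.
- by move=> b' [/SF//|->].
- move=> b' b'' [Sb'|->] [Sb''|->] //.
  + exact: tS.
  + by move=> ne; case: (Sb1 _ Sb'); rewrite /meets setIC.
  + by move=> ne; case: (Sb1 _ Sb'').
(* Members of [F] meeting [S] are served by [S] itself; those meeting only [b1] lie in [G], where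
   [rb1] applies. *)
- move=> b' Fb' [b'' [Sb'' b'b'']].
  have [[b3 [Sb3 b'b3]]|nS] := pselect (exists b3, S b3 /\ meets b' b3).
    have [//|b4 [Sb4 b'b4 rb']] := PS b' Fb'; first by exists b3.
    by exists b4; split => //; left.
  case: Sb'' b'b'' => [Sb'' b'b''|-> b'b1]; first by case: nS; exists b''.
  exists b1; split => //; first by right.
  by apply: rb1; split => // b3 Sb3 b'b3; apply: nS; exists b3.
Qed.

(** Bounded finite sums allow only finitely many terms above [1 / k.+1], and positivity makes [S]
    the union of these slices over [k]. *)
Lemma countable_esum_gt0 (R : realType) (I : choiceType) (S : set I)
    (a : I -> \bar R) (V : R) :
  (forall b, S b -> (0 < a b)%E) ->
  (forall s : seq I, uniq s -> [set` s] `<=` S -> (\sum_(b <- s) a b <= V%:E)%E) ->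
  countable S.
Proof.
move=> a0 aV.
pose Sk k := [set b | S b /\ ((k.+1%:R^-1)%:E < a b)%E].
suff -> : S = \bigcup_k Sk k.
  apply: bigcup_countable => // k _; apply: finite_set_countable.
  apply: contrapT => /(@infinite_set_fset _ _ (Num.truncn (V * k.+1%:R)).+1)[s sS].
  apply/negP; rewrite -ltnNge -(ltr_nat R).
  have : (\sum_(b <- s) a b <= V%:E)%E by apply: aV => //; move=> b /sS[].
  have : (\sum_(b <- s) (k.+1%:R^-1)%:E <= \sum_(b <- s) a b)%E.
    rewrite big_seq [leRHS]big_seq; apply: lee_sum => b /sS[_ /ltW//].
  move=> /le_trans /[apply].
  rewrite sumEFin lee_fin big_const_seq count_predT iter_addr addr0.
  rewrite -[_ *+ _]mulr_natr mulrC ler_pdivrMr// => h.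
  exact: le_lt_trans h (truncnS_gt _).
apply/seteqP; split => [b Sb|b [k _ []]//].
have := a0 _ Sb; have := a0 _ Sb.
case E : (a b) => [r| |]//; last by exists 0%N => //; split => //; rewrite E ltry.
rewrite lte_fin => r0 _; exists (Num.truncn r^-1) => //; split => //.
by rewrite E lte_fin invf_plt ?posrE// truncnS_gt.
Qed.

(** The doubling hypothesis bounds [Cd * mu B] and not [mu B] itself, so it is read at radius
    [r / 2], where it controls the ball of radius [r] from both sides. *)
Lemma doubling_qball_gt0_fin (R : realType) (d : measure_display)
    (X : measurableType d) (rho : X -> X -> R)
    (mu : {measure set X -> \bar R}) (Cd : R) (x : X) (r : R) :
  doubling_measure rho mu Cd -> 0 < r ->
  (0 < mu (qball rho x r) < +oo)%E.
Proof.
move=> dbl r0; have r20 : 0 < r / 2 by lra.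
have [] := dbl x _ r20; have -> : 2 * (r / 2) = r by lra.
by move=> -> /le_lt_trans /[apply].
Qed.

Lemma doubling_const_gt0 (R : realType) (d : measure_display)
    (X : measurableType d) (rho : X -> X -> R)
    (mu : {measure set X -> \bar R}) (Cd : R) (x : X) :
  doubling_measure rho mu Cd -> 0 < Cd.
Proof.
move=> dbl; have [h1 h2 _] := dbl x 1 ltr01.
have := lt_le_trans h1 h2.
have /andP[m0 moo] := doubling_qball_gt0_fin _ _ _ _ _ _ x _ dbl (@ltr01 R).
have mf : mu (qball rho x 1) \is a fin_num by rewrite gt0_fin_numE.
by rewrite -(fineK mf) -EFinM lte_fin pmulr_lgt0// fine_gt0// m0.
Qed.

Lemma doubling_qball_expr (R : realType) (d : measure_display)
    (X : measurableType d) (rho : X -> X -> R)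
    (mu : {measure set X -> \bar R}) (Cd : R) (x : X) (r : R) (n : nat) :
  doubling_measure rho mu Cd -> 0 < r ->
  (mu (qball rho x (2 ^+ n * r)) <= (Cd ^+ n)%:E * mu (qball rho x r))%E.
Proof.
move=> dbl r0; have Cd0 := doubling_const_gt0 _ _ _ _ _ _ x dbl.
elim: n => [|n ih]; first by rewrite !expr0 mul1r mul1e.
have r1 : 0 < 2 ^+ n * r by rewrite mulr_gt0// exprn_gt0.
have [_ + _] := dbl x _ r1; rewrite mulrA -exprS => /le_trans; apply.
by rewrite exprS EFinM -muleA lee_pmul2l.
Qed.

(** Disjoint balls of positive measure, each dominated by its share of a finite integral, are
    countably many. Countable subadditivity then applies to the dilated balls: each dilation costs
    [Cd ^+ N], and disjointness keeps the sum of the shares below the full integral. *)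
Lemma mu_le_enlarged_cover (R : realType) (d : measure_display)
    (X : measurableType d) (rho : X -> X -> R)
    (mu : {measure set X -> \bar R}) (Cd : R) (N : nat)
    (h : X -> \bar R) (S : set (X * R)) (E : set X) :
  (forall x r, measurable (qball rho x r)) ->
  doubling_measure rho mu Cd -> 0 < Cd ->
  measurable_fun setT h -> (forall x, (0 <= h x)%E) ->
  (forall b, S b -> 0 < b.2 /\
    (mu (qball rho b.1 b.2) <= \int[mu]_(x in qball rho b.1 b.2) h x)%E) ->
  trivIset S (fun b => qball rho b.1 b.2) ->
  measurable E -> E `<=` \bigcup_(b in S) qball rho b.1 (2 ^+ N * b.2) ->
  (mu E <= (Cd ^+ N)%:E * \int[mu]_x h x)%E.
Proof.
move=> mB dbl C0 mh h0 SP tS mE EU.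
have CN0 : 0 < Cd ^+ N by rewrite exprn_gt0.
have [[V VE]|hoo] : (exists V, \int[mu]_x h x = V%:E)%E \/ (\int[mu]_x h x = +oo)%E.
  have : (0 <= \int[mu]_x h x)%E by exact: integral_ge0.
  by case: (integral _ _ _) => [V _| _|//]; [left; exists V|right].
2: by rewrite hoo gt0_muley ?leey// lte_fin.
have mhB A : measurable_fun A h by exact: measurable_funTS.
have : countable S.
  apply: (@countable_esum_gt0 R _ S (fun b => mu (qball rho b.1 b.2)) V).
    move=> b /SP[b0 _].
    by have /andP[] := doubling_qball_gt0_fin _ _ _ _ _ _ b.1 _ dbl b0.
  move=> s us sS; rewrite -VE.
  apply: (@le_trans _ _ (\sum_(b <- s) \int[mu]_(x in qball rho b.1 b.2) h x)%E).
    by rewrite big_seq [leRHS]big_seq; apply: lee_sum => b /sS/SP[].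
  rewrite -(@ge0_integral_bigsetU _ _ _ mu _ (fun b => qball rho b.1 b.2))//.
  - by apply: ge0_subset_integral => //; exact: bigsetU_measurable.
  - exact: sub_trivIset tS.
move=> /countable_injP[f finj].
(* By injectivity at most one ball of [S] has code [n], so [B n] and [B' n] are a ball and its
   dilate, or both empty. *)
pose B n := \bigcup_(b in S `&` f @^-1` [set n]) qball rho b.1 b.2.
pose B' n := \bigcup_(b in S `&` f @^-1` [set n]) qball rho b.1 (2 ^+ N * b.2).
have BE n : (B n = set0 /\ B' n = set0) \/ exists2 b, S b &
    B n = qball rho b.1 b.2 /\ B' n = qball rho b.1 (2 ^+ N * b.2).
  have [[b [Sb fb]]|nb] := pselect (exists b, S b /\ f b = n).
    have SE : S `&` f @^-1` [set n] = [set b].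
      apply/seteqP; split => [b' [Sb' /= fb']|_ ->]//=.
      by apply: finj; [exact/mem_set|exact/mem_set|rewrite fb' fb].
    by right; exists b => //; rewrite /B /B' SE !bigcup_set1.
  have SE : S `&` f @^-1` [set n] = set0.
    by apply/seteqP; split => // b [Sb fb]; apply: nb; exists b.
  by left; rewrite /B /B' SE !bigcup_set0.
have mBn n : measurable (B n) by case: (BE n) => [[-> _]|[b _ [-> _]]].
have mBn' n : measurable (B' n) by case: (BE n) => [[_ ->]|[b _ [_ ->]]].
apply: (@le_trans _ _ (\sum_(n <oo) mu (B' n))%E).
  apply: measure_sigma_subadditive => // x /EU[b Sb bx].
  by exists (f b) => //; exists b.
apply: (@le_trans _ _ (\sum_(n <oo) (Cd ^+ N)%:E * \int[mu]_(x in B n) h x)%E).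
  apply: lee_nneseries => // n _.
  case: (BE n) => [[-> ->]|[b /SP[b0 hb] [-> ->]]].
    by rewrite measure0 integral_set0 mule0.
  apply: le_trans (doubling_qball_expr _ _ _ _ _ _ _ _ _ dbl b0) _.
  by rewrite lee_pmul2l.
rewrite nneseriesZl; last by move=> *; exact: integral_ge0.
rewrite lee_pmul2l// -ge0_integral_bigcup//.
  by apply: ge0_subset_integral => //; exact: bigcup_measurable.
move=> n m _ _ [x [[b [Sb <-] bx] [b' [Sb' <-] b'x]]].
by congr f; apply: tS => //; exists x.
Qed.
Lemma exists_le_expr2 (R : realType) (x : R) : exists n : nat, x <= 2 ^+ n.
Proof.
exists (Num.truncn x).+1; rewrite ltW// -natrX.
by apply: lt_trans (truncnS_gt _) _; rewrite ltr_nat; exact: ltn_expl.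
Qed.

Lemma nondecreasing_mu_bigcup_le (R : realType) (d : measure_display)
    (X : measurableType d) (mu : {measure set X -> \bar R}) (F : (set X)^nat)
    (V : \bar R) :
  (forall n, measurable (F n)) -> nondecreasing_seq F ->
  (forall n, (mu (F n) <= V)%E) -> (mu (\bigcup_n F n) <= V)%E.
Proof.
move=> mF ndF FV.
have cF := @nondecreasing_cvg_mu _ _ _ mu F mF (bigcup_measurable (fun n _ => mF n)) ndF.
rewrite -(cvg_lim _ cF)//; apply: lime_le; first by apply/cvg_ex; eexists; exact: cF.
exact: nearW.
Qed.

Lemma qball_le (R : realType) (X : Type) (rho : X -> X -> R) (x : X) (r s : R) :
  r <= s -> qball rho x r `<=` qball rho x s.
Proof. by move=> rs y /lt_le_trans; apply. Qed.

Lemma bigcup_qball (R : realType) (X : Type) (rho : X -> X -> R) (x : X) :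
  \bigcup_n qball rho x n%:R = setT.
Proof.
apply/seteqP; split => // y _; exists (Num.truncn (rho x y)).+1 => //.
exact: truncnS_gt.
Qed.

Lemma qball_measure_unbounded (R : realType) (d : measure_display)
    (X : measurableType d) (rho : X -> X -> R)
    (mu : {measure set X -> \bar R}) (x : X) (V : R) :
  (forall x r, measurable (qball rho x r)) -> mu setT = +oo%E ->
  exists n : nat, (V%:E < mu (qball rho x n%:R))%E.
Proof.
move=> mB muX; apply: contrapT => /forallNP nV.
suff : (mu (\bigcup_n qball rho x n%:R) <= V%:E)%E.
  by rewrite bigcup_qball muX leye_eq.
apply: nondecreasing_mu_bigcup_le => // [m n mn|n].
  by apply/subsetPset; apply: qball_le; rewrite ler_nat.
by rewrite leNgt; apply/negP/nV.
Qed.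

(** [K * (r + K * s)] is what two quasi-triangle inequalities give. As [1 <= K] and [s <= 4 * r],
    its two terms are at most [K ^+ 2 * r] and [4 * K ^+ 2 * r], whence the 5. *)
Lemma dilation_le (R : realType) (K r s : R) (N : nat) :
  1 <= K -> 5 * K ^+ 2 <= 2 ^+ N -> 0 < r -> s <= 4 * r ->
  K * (r + K * s) <= 2 ^+ N * r.
Proof.
move=> K1 KN r0 sr; have K0 : 0 < K by lra.
have h1 : K * (K * s) <= K * (K * (4 * r)) by rewrite !ler_pM2l.
have h2 : 5 * K ^+ 2 * r <= 2 ^+ N * r by rewrite ler_pM2r.
have h4 : K * r <= K * (K * r) by rewrite ler_peMl// mulr_ge0// ltW.
apply: le_trans h2; rewrite expr2 mulrDr; lra.
Qed.

(* The hypothesis [mu setT = +oo] bounds the radii of the balls meeting a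
   fixed ball: they have measure at most [\int h], whereas a ball of large
   radius meeting [qball rho x0 n] has, after a fixed dilation, large measure. *)
Lemma measure_le_of_ball_averages (R : realType) (d : measure_display)
    (X : measurableType d) (rho : X -> X -> R)
    (mu : {measure set X -> \bar R}) (Cd : R) :
  homogeneous_type rho mu Cd -> mu setT = +oo%E ->
  exists2 C : R, 0 < C & forall (h : X -> \bar R) (E : set X),
    measurable_fun setT h -> (forall x, (0 <= h x)%E) -> measurable E ->
    (forall x, E x -> exists b : X * R, [/\ 0 < b.2, qball rho b.1 b.2 x &
      (mu (qball rho b.1 b.2) <= \int[mu]_(x in qball rho b.1 b.2) h x)%E]) ->
    (mu E <= C%:E * \int[mu]_x h x)%E.
Proof.
move=> [[rho0 rho_eq0 rhoC [K K1 rhoD]] mB dbl] muX.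
have /set0P[x0 _] : [set: X] != set0.
  by apply/eqP => X0; move: muX; rewrite X0 measure0.
have C0 := doubling_const_gt0 _ _ _ _ _ _ x0 dbl.
have K0 : 0 < K by lra.
have [N KN] := exists_le_expr2 _ (5 * K ^+ 2).
have CN0 : 0 < Cd ^+ N by rewrite exprn_gt0.
exists (Cd ^+ N) => // h E mh h0 mE EB.
have [[V VE]|hoo] : (exists V, \int[mu]_x h x = V%:E)%E \/ (\int[mu]_x h x = +oo)%E.
- have : (0 <= \int[mu]_x h x)%E by exact: integral_ge0.
  by case: (integral _ _ _) => [V _| _|//]; [left; exists V|right].
2: by rewrite hoo gt0_muley ?leey// lte_fin.
(* The selection lemma needs bounded radii, so [E] is exhausted by its intersections with balls
   around [x0]. *)
have -> : E = \bigcup_n (E `&` qball rho x0 n%:R).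
  by rewrite -setI_bigcupr bigcup_qball setIT.
apply: nondecreasing_mu_bigcup_le => [n|m n mn|n]; first exact: measurableI.
  by apply/subsetPset; apply: setIS; apply: qball_le; rewrite ler_nat.
pose U (b : X * R) := qball rho b.1 b.2.
pose F := [set b : X * R | [/\ 0 < b.2, (mu (U b) <= \int[mu]_(x in U b) h x)%E &
  U b `&` qball rho x0 n%:R !=set0]].
have mhB A : measurable_fun A h by exact: measurable_funTS.
(* Dilated by [2 ^+ N], a ball of [F] has measure at most [Cd ^+ N * V], so it cannot contain the
   ball of radius [m]; a radius above [m + n] would force this inclusion. *)
have [m mV] := qball_measure_unbounded _ _ _ rho mu x0 (Cd ^+ N * V) mB muX.
have radF b : F b -> 0 < b.2 <= m%:R + n%:R.
  case: b => y r [/= r0 yV [z [/= yz x0z]]]; rewrite r0/= leNgt; apply/negP => mnr.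
  have : (mu (qball rho x0 m%:R) <= (Cd ^+ N * V)%:E)%E; last by rewrite leNgt mV.
  apply: (@le_trans _ _ (mu (qball rho y (2 ^+ N * r)))).
    apply: le_measure; [exact/mem_set|exact/mem_set|move=> w /= x0w].
    rewrite /qball/=.
    have h1 := rhoD y z w; have h2 := rhoD z x0 w.
    rewrite /qball /= in yz x0z x0w; rewrite (rhoC z x0) in h2.
    have h3 : K * (rho y z + rho z w) < K * (r + K * (n%:R + m%:R)).
      rewrite ltr_pM2l// ltr_leD//; apply: le_trans h2 _.
      by rewrite ler_pM2l// lerD// ltW.
    apply: le_lt_trans h1 _; apply: lt_le_trans h3 _.
    by apply: (dilation_le _ _ _ _ _ K1 KN r0); lra.
  apply: le_trans (doubling_qball_expr _ _ _ _ _ _ _ _ _ dbl r0) _.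
  rewrite EFinM lee_pmul2l ?lte_fin// (le_trans yV)// -VE.
  by apply: ge0_subset_integral => //; exact: mB.
have U0 b : F b -> U b !=set0 by move=> [_ _ [z [bz _]]]; exists z.
have [S [SF tS SU]] := vitali_selection _ _ _ _ U (fun b => b.2) _ radF U0.
apply: (mu_le_enlarged_cover _ _ _ rho mu Cd N h S) => //.
- by move=> b /SF[].
- exact: measurableI.
move=> x [/EB[b [b0 bx bh]] x0x].
have [|b' [Sb' [z [/= bz b'z]] bb']] := SU b; first by split => //; exists x.
exists b' => //; rewrite /qball /=; rewrite /U /qball /= in bz b'z bx.
have h1 := rhoD b'.1 z x; have h2 := rhoD z b.1 x; rewrite (rhoC z b.1) in h2.
(* [z] and [x] both lie in the ball [b], whose radius is at most [2 * b'.2]: this is the [4 * r] of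
   [dilation_le]. *)
have h3 : K * (rho b'.1 z + rho z x) < K * (b'.2 + K * (b.2 + b.2)).
  rewrite ltr_pM2l// ltr_leD//; apply: le_trans h2 _.
  by rewrite ler_pM2l// lerD// ltW.
have [b'0 _ _] := SF _ Sb'.
apply: le_lt_trans h1 _; apply: lt_le_trans h3 _.
by apply: (dilation_le _ _ _ _ _ K1 KN b'0); lra.
Qed.

(** * Averages over balls and the sum over dyadic scales *)

(** This is [h_t] as a function of the value [u = f x]. The cut-off at [t / 2] leaves only finitely
    many of the scales [s * 2 ^+ k] active for a given [u]. *)
Definition upper_part (R : realType) (A : R -> R) (t u : R) : R :=
  if t < 2 * u then A (u / t) else 0.
Arguments upper_part {R}.

Lemma upper_part_ge0 (R : realType) (A : R -> R) (t u : R) :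
  (forall v, 0 <= v -> 0 <= A v) -> 0 < t -> 0 <= upper_part A t u.
Proof.
move=> A0 t0; rewrite /upper_part; case: ifPn => // tu.
by apply: A0; rewrite divr_ge0 ?ltW//; lra.
Qed.

Lemma measurable_comp_young (R : realType) (d : measure_display)
    (X : measurableType d) (A : R -> R) (f : X -> R) :
  {within [set` `[0, +oo[%R], continuous A} ->
  measurable_fun setT f -> (forall x, 0 <= f x) ->
  measurable_fun setT (fun x => A (f x)).
Proof.
move=> cA mf f0.
apply: (@measurable_comp _ _ _ X R R [set` `[0, +oo[%R] A setT f) => //.
- by move=> _ [x _ <-] /=; rewrite in_itv/= f0.
- exact: subspace_continuous_measurable_fun.
Qed.

Lemma measurable_upper_part (R : realType) (d : measure_display)
    (X : measurableType d) (A : R -> R) (t : R) (f : X -> R) :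
  {within [set` `[0, +oo[%R], continuous A} -> 0 < t ->
  measurable_fun setT f -> (forall x, 0 <= f x) ->
  measurable_fun setT (fun x => upper_part A t (f x)).
Proof.
move=> cA t0 mf f0; apply: measurable_fun_ifT => //.
- by apply: measurable_fun_ltr => //; exact: measurable_funM.
- apply: measurable_comp_young => //; first exact: measurable_funM.
  by move=> x; rewrite divr_ge0// ltW.
Qed.

(** A [t] below the norm is not admissible, so [mu B] is less than the integral of [A (f / t)].
    Where [f <= t / 2] the integrand is at most [A (2^-1) <= 2^-1]; this part contributes at most
    half of [mu B] and is absorbed on the left. *)
Lemma orlicz_norm_gt_average (R : realType) (d : measure_display)
    (X : measurableType d) (mu : {measure set X -> \bar R}) (A : R -> R)
    (B : set X) (f : X -> R) (t : R) :
  {within [set` `[0, +oo[%R], continuous A} ->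
  (forall u v, 0 <= u -> u <= v -> A u <= A v) ->
  (forall v, 0 <= v -> 0 <= A v) -> A (2^-1) <= 2^-1 ->
  measurable_fun setT f -> (forall x, 0 <= f x) ->
  measurable B -> (0 < mu B < +oo)%E -> 0 < t ->
  (t%:E < orlicz_norm mu A B f)%E ->
  (mu B <= \int[mu]_(x in B) (2 * upper_part A t (f x))%:E)%E.
Proof.
move=> cA Am A0 A2 mf f0 mB /andP[B0 Boo] t0 tn.
have mfB D (g : X -> R) : measurable_fun setT g -> measurable_fun D (EFin \o g).
  by move=> mg; apply/measurable_EFinP; exact: measurable_funTS.
have mA : measurable_fun setT (fun x => A (f x / t)).
  apply: measurable_comp_young => //; first exact: measurable_funM.
  by move=> x; rewrite divr_ge0// ltW.
have mU := measurable_upper_part _ _ _ A t f cA t0 mf f0.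
have ft0 x : 0 <= f x / t by rewrite divr_ge0// ltW.
have Af0 x : 0 <= A (f x / t) by exact: A0.
have U0 x : 0 <= upper_part A t (f x) by exact: upper_part_ge0.
have AE : (\int[mu]_(x in B) (A (`|f x| / t))%:E =
           \int[mu]_(x in B) (A (f x / t))%:E)%E.
  by apply: eq_integral => x _; rewrite ger0_norm.
have [m mE] : exists m, mu B = m%:E.
  by exists (fine (mu B)); rewrite fineK// gt0_fin_numE.
have m0 : 0 < m by rewrite -lte_fin -mE.
have lt_m : (mu B < \int[mu]_(x in B) (A (f x / t))%:E)%E.
  rewrite ltNge; apply/negP => le_m.
  move: tn; rewrite ltNge => /negP; apply; apply: ereal_inf_lbound.
  exists t => //; split => //; rewrite AE mE inver gt_eqF//.
  by rewrite lee_pdivrMl// mule1 -mE.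
have : (2%:E * \int[mu]_(x in B) (A (f x / t))%:E <=
        mu B + \int[mu]_(x in B) (2 * upper_part A t (f x))%:E)%E.
  rewrite -ge0_integralZl//; [|exact: (mfB)|by move=> x _; rewrite lee_fin].
  rewrite -[X in (X + _)%E]mul1e -(integral_cst mu mB 1%:E) -ge0_integralD//; first last.
  - exact: (mfB _ _ (measurable_funM _ _)).
  - by move=> x _; rewrite lee_fin mulr_ge0.
  apply: ge0_le_integral => //.
  - by move=> x _; rewrite -EFinM lee_fin mulr_ge0.
  - exact: (mfB _ (fun x => 2 * A (f x / t)) (measurable_funM _ _)).
  - apply: emeasurable_funD => //; exact: (mfB _ _ (measurable_funM _ _)).
  move=> x _; rewrite -EFinM -EFinD lee_fin /upper_part; case: ltP => tf.
    by rewrite lerDr.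
  have : A (f x / t) <= A (2^-1).
    apply: Am => //.
    by rewrite ler_pdivrMr//; lra.
  by lra.
have : (0 <= \int[mu]_(x in B) (2 * upper_part A t (f x))%:E)%E.
  by apply: integral_ge0 => x _; rewrite lee_fin mulr_ge0.
case: (\int[mu]_(x in B) (2 * upper_part A t (f x))%:E)%E => [I _|_|//]; last by rewrite leey.
move: lt_m; rewrite mE; case: (\int[mu]_(x in B) (A (f x / t))%:E)%E => [J| |//].
  by rewrite lte_fin -EFinM -EFinD !lee_fin; lra.
by rewrite gt0_muley// lte_fin.
Qed.

(** Only scales [s * 2 ^+ k < 2 * u] contribute. Counting down from the largest, the one at distance
    [i] has [u / (s * 2 ^+ k) <= 2 ^+ i], and its weight is at most the [p]-th power of [2 * u]
    divided by that of [2 ^+ i]; the terms are thus dominated by those of the dyadic sum. *)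
Lemma sum_upper_part_le (R : realType) (A : R -> R) (p c S s u : R) (n : nat) :
  (forall u v, 0 <= u -> u <= v -> A u <= A v) ->
  (forall v, 0 <= v -> 0 <= A v) -> 0 <= p -> 1 <= c -> 0 < s -> 0 <= u ->
  (forall m, \sum_(0 <= j < m) A (c * 2 ^+ j) / (2 ^+ j) `^ p <= S) ->
  \sum_(0 <= k < n) (s * 2 ^+ k) `^ p * upper_part A (s * 2 ^+ k) u
    <= (2 * u) `^ p * S.
Proof.
move=> Am A0 p0 c1 s0 u0 AS.
have e0 k : 0 < 2 ^+ k :> R by rewrite exprn_gt0.
have se0 k : 0 < s * 2 ^+ k by rewrite mulr_gt0.
have exm : exists m, 2 * u <= s * 2 ^+ m.
  have [m h] := exists_le_expr2 _ (2 * u / s); exists m.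
  by rewrite [s * _]mulrC -ler_pdivrMr.
have [m um minm] := ex_minnP exm.
pose F k := (s * 2 ^+ k) `^ p * upper_part A (s * 2 ^+ k) u.
rewrite -[leLHS]/(\sum_(0 <= k < n) F k).
have F0 k : 0 <= F k by rewrite mulr_ge0 ?powR_ge0// upper_part_ge0.
apply: (@le_trans _ _ (\sum_(0 <= k < maxn m n) F k)).
  rewrite [leRHS](@big_cat_nat _ _ _ n)//= ?leq_maxr//.
  by rewrite lerDl sumr_ge0.
rewrite (@big_cat_nat _ _ _ m)//= ?leq_maxl// [X in _ + X]big_nat_cond.
rewrite [X in _ + X]big1 ?addr0; last first.
  move=> k /andP[/andP[mk _] _]; rewrite /F /upper_part ifF ?mulr0//.
  apply/negbTE; rewrite -leNgt (le_trans um)// ler_pM2l//.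
  by rewrite ler_weXn2l// ler1n.
apply: (@le_trans _ _ ((2 * u) `^ p * \sum_(0 <= j < m) A (c * 2 ^+ j) / (2 ^+ j) `^ p)); last first.
  by rewrite ler_wpM2l// powR_ge0.
(* Reversal matches the scale of index [m - i.+1] with the [i]-th dyadic term; minimality of [m]
   gives [s * 2 ^+ m.-1 < 2 * u]. *)
rewrite big_nat_rev/= add0n mulr_sumr !big_nat; apply: ler_sum => i /andP[_ im].
have mE : (m.-1 = (m - i.+1) + i)%N by lia.
have um1 : s * 2 ^+ m.-1 < 2 * u.
  by rewrite ltNge; apply/negP => /minm; lia.
set k := (m - i.+1)%N in mE *.
have m1 : 2 ^+ m = 2 * 2 ^+ m.-1 :> R by rewrite -exprS prednK//; lia.
have sE : s * 2 ^+ m.-1 = (s * 2 ^+ k) * 2 ^+ i by rewrite mE exprD mulrA.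
have : (s * 2 ^+ k) `^ p * (2 ^+ i) `^ p <= (2 * u) `^ p.
  rewrite -powRM ?(ltW (se0 _)) ?(ltW (e0 _))// -sE.
  by rewrite ge0_ler_powR ?nnegrE ?mulr_ge0// ltW.
rewrite -ler_pdivlMr ?powR_gt0// => h.
rewrite mulrA [leRHS]mulrAC /F; apply: ler_pM; rewrite ?powR_ge0 ?upper_part_ge0//.
rewrite /upper_part; case: ifPn => _; last by rewrite A0// mulr_ge0 ?(ltW (e0 _))//; lra.
apply: Am; first by rewrite divr_ge0 ?(ltW (se0 _)).
rewrite ler_pdivrMr//.
have -> : c * 2 ^+ i * (s * 2 ^+ k) = c * (s * 2 ^+ m.-1) by rewrite sE; ring.
have h1 : 1 * (s * 2 ^+ m.-1) <= c * (s * 2 ^+ m.-1) by rewrite ler_pM2r.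
by rewrite m1 in um; lra.
Qed.

(** A discrete layer-cake bound: the largest [k < n] whose level is below [y] alone contributes a
    term at least [y]. *)
Lemma le_sum_levels (R : realType) (p s y : R) (n : nat) :
  s `^ p < y -> y <= (s * 2 ^+ n) `^ p ->
  y <= \sum_(0 <= k < n) (s * 2 ^+ k.+1) `^ p * ((s * 2 ^+ k) `^ p < y)%R%:R.
Proof.
move=> sy; elim: n => [|n ih]; first by rewrite expr0 mulr1 leNgt sy.
rewrite big_nat_recr//= => yn.
have [/ih h|h] := leP y ((s * 2 ^+ n) `^ p); first by rewrite mulr0 addr0.
rewrite mulr1 (le_trans yn)// lerDr sumr_ge0// => k _.
by rewrite mulr_ge0 ?powR_ge0.
Qed.

(** Applied to the range of a simple function, it lets finitely many dyadic levels capture all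
    positive values. *)
Lemma finite_set_pos_bounds (R : realType) (D : set R) : finite_set D ->
  exists e M : R, 0 < e /\ forall y, D y -> 0 < y -> e < y <= M.
Proof.
move=> /finite_seqP[r ->]; elim: r => [|y r [e [M [e0 ih]]]].
  by exists 1, 1; split => // y.
exists (if 0 < y then Num.min e (y / 2) else e), (Num.max M y); split.
  by case: ifPn => // y0; rewrite lt_min e0 divr_gt0.
move=> z; rewrite /= inE => /orP[/eqP ->|zr] z0.
  by rewrite z0 gt_min le_max lexx !orbT andbT; apply/orP; right; lra.
have /andP[ez zM] := ih z zr z0; rewrite le_max zM/= andbT.
by case: ifPn => // y0; rewrite gt_min ez.
Qed.

(** * Integrals of possibly non-measurable functions and the strong-type bound *)

Import HBNNSimple.

Lemma ge0_integral_le_nnsfun (R : realType) (d : measure_display)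
    (X : measurableType d) (mu : {measure set X -> \bar R}) (F : X -> \bar R)
    (V : \bar R) :
  (forall x, (0 <= F x)%E) ->
  (forall g : {nnsfun X >-> R}, (forall x, ((g x)%:E <= F x)%E) ->
    (\int[mu]_x (g x)%:E <= V)%E) ->
  (\int[mu]_x F x <= V)%E.
Proof.
move=> F0 FV; rewrite ge0_integralTE//; apply: ge_ereal_sup => _ [g gF <-].
by rewrite -integralT_nnsfun; exact: FV.
Qed.

(** Simple functions below [F] are also below [G], and the integrals are suprema over these;
    measurability does not enter. *)
Lemma ge0_le_integral_nonmeasurable (R : realType) (d : measure_display)
    (X : measurableType d) (mu : {measure set X -> \bar R})
    (F G : X -> \bar R) :
  (forall x, (0 <= F x)%E) -> (forall x, (F x <= G x)%E) ->
  (\int[mu]_x F x <= \int[mu]_x G x)%E.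
Proof.
move=> F0 FG; have G0 x : (0 <= G x)%E := le_trans (F0 x) (FG x).
rewrite !ge0_integralTE//; apply: le_ereal_sup => _ [g gF <-].
by exists g => // x; exact: le_trans (gF x) (FG x).
Qed.

Lemma orlicz_norm_ge0 (R : realType) (d : measure_display)
    (X : measurableType d) (mu : {measure set X -> \bar R}) (A : R -> R)
    (B : set X) (f : X -> R) : (0 <= orlicz_norm mu A B f)%E.
Proof. by apply: le_ereal_inf_tmp => _ [l [l0 _] <-]; rewrite lee_fin ltW. Qed.

(** The ball of centre [x] and radius 1 contains [x], so the supremum is over a nonempty set and
    cannot be the default [-oo]. *)
Lemma orlicz_maximal_ge0 (R : realType) (d : measure_display)
    (X : measurableType d) (rho : X -> X -> R)
    (mu : {measure set X -> \bar R}) (A : R -> R) (f : X -> R) (x : X) :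
  quasimetric rho -> (0 <= orlicz_maximal rho mu A f x)%E.
Proof.
move=> [_ rho_eq0 _ _].
apply: (@le_trans _ _ (orlicz_norm mu A (qball rho x 1) f)); first exact: orlicz_norm_ge0.
apply: ereal_sup_ubound; exists (x, 1) => //; split => //=.
by rewrite /qball/= (rho_eq0 x x).2.
Qed.

Lemma bounded_on_Lp_integral (R : realType) (d : measure_display)
    (X : measurableType d) (mu : {measure set X -> \bar R}) (p : R)
    (T : (X -> R) -> X -> \bar R) : 0 < p ->
  bounded_on_Lp mu p T <-> exists2 C : R, 0 < C &
    forall f : X -> R, measurable_fun setT f -> (forall x, 0 <= f x) ->
      (\int[mu]_x (`|T f x| `^ p) <= C%:E * \int[mu]_x ((f x) `^ p)%:E)%E.
Proof.
move=> p0.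
have p'0 : 0 <= p^-1 by rewrite invr_ge0 ltW.
have NE (f : X -> R) : (forall x, 0 <= f x) ->
    (\int[mu]_x (`|(f x)%:E| `^ p) = \int[mu]_x ((f x) `^ p)%:E)%E.
  by move=> f0; apply: eq_integral => x _; rewrite /= ger0_norm.
have I0 (F : X -> \bar R) : (0 <= \int[mu]_x (`|F x| `^ p))%E.
  by apply: integral_ge0 => x _; exact: poweR_ge0.
have J0 (f : X -> R) : (0 <= \int[mu]_x ((f x) `^ p)%:E)%E.
  by apply: integral_ge0 => x _; rewrite lee_fin powR_ge0.
split => -[C C0 hC].
- exists (C `^ p); first exact: powR_gt0.
  move=> f mf f0; have := hC f mf f0.
  move/(gt0_ler_poweR (ltW p0)); rewrite !in_itv/= !leey Lnorm_ge0.
  rewrite mule_ge0 ?Lnorm_ge0 ?lee_fin ?(ltW C0)// => /(_ isT isT).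
  rewrite poweRM ?Lnorm_ge0 ?lee_fin ?(ltW C0)// !poweR_Lnorm ?gt_eqF//.
  by rewrite [X in (_ <= _ * X)%E -> _](NE f f0).
- exists (C `^ p^-1); first exact: powR_gt0.
  move=> f mf f0; rewrite unlock -poweR_EFin -poweRM ?I0 ?lee_fin ?(ltW C0)//.
  apply: gt0_ler_poweR => //; rewrite ?in_itv/= ?leey ?andbT ?I0//.
    by rewrite mule_ge0 ?I0 ?lee_fin ?(ltW C0).
  by rewrite [X in (_ <= _ * X)%E](NE f f0); exact: hC.
Qed.

Lemma orlicz_maximal_Lp_bound (R : realType) (d : measure_display)
    (X : measurableType d) (rho : X -> X -> R)
    (mu : {measure set X -> \bar R}) (Cd p c S : R) (A : R -> R) :
  homogeneous_type rho mu Cd -> mu setT = +oo%E -> 1 <= p ->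
  young_function A -> A (2^-1) <= 2^-1 -> 1 <= c ->
  (forall m, \sum_(0 <= j < m) A (c * 2 ^+ j) / (2 ^+ j) `^ p <= S) ->
  exists2 C : R, 0 < C &
    forall f : X -> R, measurable_fun setT f -> (forall x, 0 <= f x) ->
      (\int[mu]_x (`|orlicz_maximal rho mu A f x| `^ p) <=
       C%:E * \int[mu]_x ((f x) `^ p)%:E)%E.
Proof.
move=> hX muX p1 [_ Am cA A0 _] A2 c1 AS; have [qm mB dbl] := hX.
have [C C0 weak] := measure_le_of_ball_averages _ _ _ _ _ _ hX muX.
have p0 : 0 < p by lra.
have S0 : 0 <= S by have := AS 0%N; rewrite big_nil.
(* [C] is the weak-type constant, the next 2 the factor in front of [upper_part], and the factor at
   [S] comes from [sum_upper_part_le]. The outer power of 2 pays for the weights at [t k.+1] instead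
   of [t k]. One is added below since [D] vanishes with [S]. *)
pose D := 2 `^ p * (C * (2 * (2 `^ p * S))).
exists (D + 1).
  rewrite ltr_wpDl// mulr_ge0 ?powR_ge0// mulr_ge0 ?(ltW C0)// mulr_ge0//.
  by rewrite mulr_ge0// powR_ge0.
move=> f mf f0.
apply: (@le_trans _ _ (D%:E * \int[mu]_x ((f x) `^ p)%:E)%E); last first.
  apply: lee_wpmul2r; last by rewrite lee_fin lerDl.
  by apply: integral_ge0 => x _; rewrite lee_fin powR_ge0.
apply: ge0_integral_le_nnsfun => [x|g gM]; first exact: poweR_ge0.
have g0 x : 0 <= g x by exact: fun_ge0.
have mg : measurable_fun setT g by [].
have [e [M [e0 gb]]] := finite_set_pos_bounds _ _ (@fimfunP _ _ g).
(* The [p]-th power of [s] is [e], so the levels start below every positive value of [g]. *)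
pose s := e `^ p^-1.
have s0 : 0 < s by exact: powR_gt0.
have sE : s `^ p = e by rewrite -powRrM mulVf ?gt_eqF// powRr1// ltW.
(* The last level reaches [M]: the [p]-th power of [t n] is [e] times that of [2 ^+ n], hence at
   least [e * 2 ^+ n] because [1 <= p]. *)
have [n Mn] := exists_le_expr2 _ (M / e).
pose t k := s * 2 ^+ k.
have t0 k : 0 < t k by rewrite mulr_gt0// exprn_gt0.
have ge_t x : 0 < g x -> g x <= (t n) `^ p.
  move=> gx; have /andP[_ gxM] := gb _ (ex_intro2 _ _ x I erefl) gx.
  rewrite (le_trans gxM)// powRM ?(ltW s0) ?exprn_ge0// sE mulrC.
  rewrite -ler_pdivrMr// (le_trans Mn)// -[leLHS]powRr1 ?exprn_ge0//.
  by rewrite ler_powR// exprn_ege1// ler1n.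
(* These sets are measurable, and on [L k] the bound [gM] forces the maximal function above
   [t k]. *)
pose L k := [set x | (t k) `^ p < g x].
have mL k : measurable (L k).
  rewrite -[L k]setTI.
  have mc : measurable_fun setT (fun _ : X => (t k) `^ p) by exact: measurable_cst.
  have mcg := measurable_fun_ltr mc mg.
  exact: (mcg measurableT [set true] I).
have mU k : measurable_fun setT (fun x => upper_part A (t k) (f x)).
  exact: measurable_upper_part.
have U0 k x : 0 <= upper_part A (t k) (f x) by exact: upper_part_ge0.
have muL k : (mu (L k) <= C%:E * \int[mu]_x (2 * upper_part A (t k) (f x))%:E)%E.
  apply: weak => //.
  - by apply/measurable_EFinP; exact: measurable_funM.
  - by move=> x; rewrite lee_fin mulr_ge0.
  move=> x; rewrite /L/= => tg.
  have tM : ((t k)%:E < orlicz_maximal rho mu A f x)%E.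
    have M0 := orlicz_maximal_ge0 _ _ _ _ mu A f x qm.
    rewrite ltNge; apply/negP => Mt; have := gM x; apply/negP; rewrite -ltNge.
    apply: (@le_lt_trans _ _ ((t k)%:E `^ p)%E); last by rewrite poweR_EFin lte_fin.
    rewrite gee0_abs//; apply: gt0_ler_poweR; rewrite ?in_itv/= ?leey ?andbT//.
      exact: ltW.
    by rewrite lee_fin ltW.
  have [_ [b [b0 bx] <-] tb] := ereal_sup_gt tM.
  exists b; split => //.
  apply: (orlicz_norm_gt_average _ _ _ _ A) => //.
  exact: (doubling_qball_gt0_fin _ _ _ _ _ _ _ _ dbl).
pose w k := (t k.+1) `^ p.
have w0 k : 0 <= w k by exact: powR_ge0.
have wE k : w k = 2 `^ p * (t k) `^ p.
  by rewrite /w -powRM ?(ltW (t0 _))// /t exprS mulrCA.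
apply: (@le_trans _ _ (\int[mu]_x \sum_(0 <= k < n) (w k * \1_(L k) x)%:E)%E).
  apply: ge0_le_integral_nonmeasurable => x; first by rewrite lee_fin.
  rewrite sumEFin lee_fin.
  have [gx0|gx] := leP (g x) 0.
    by rewrite (le_trans gx0)// sumr_ge0// => k _; rewrite mulr_ge0.
  have /andP[ex _] := gb _ (ex_intro2 _ _ x I erefl) gx.
  apply: le_trans (le_sum_levels _ p s _ n _ (ge_t x gx)) _; first by rewrite sE.
  apply: ler_sum => k _; rewrite indicE /w /L.
  rewrite (_ : (x \in _) = ((t k) `^ p < g x))//.
  by apply/idP/idP => [/set_mem//|?]; exact/mem_set.
rewrite ge0_integral_sum//; first last.
- by move=> k x _; rewrite lee_fin mulr_ge0.
- by move=> k; apply/measurable_EFinP; exact: measurable_funM.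
have f'0 k x : 0 <= w k * (C * (2 * upper_part A (t k) (f x))).
  by rewrite !mulr_ge0// ltW.
have mf' k : measurable_fun setT (fun x => (w k * (C * (2 * upper_part A (t k) (f x))))%:E).
  by apply/measurable_EFinP; do 3 apply: measurable_funM => //.
apply: (@le_trans _ _ (\sum_(0 <= k < n)
    \int[mu]_x (w k * (C * (2 * upper_part A (t k) (f x))))%:E)%E).
  apply: lee_sum => k _.
  have I1 : (\int[mu]_x (w k * \1_(L k) x)%:E = (w k)%:E * mu (L k))%E.
    by rewrite -[L k in RHS]setIT -integral_indic// -ge0_integralZl_EFin//;
      exact/measurable_EFinP.
  have I2 : (\int[mu]_x (w k * (C * (2 * upper_part A (t k) (f x))))%:E =
      (w k)%:E * (C%:E * \int[mu]_x (2 * upper_part A (t k) (f x))%:E))%E.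
    have u0 x : 0 <= 2 * upper_part A (t k) (f x) by rewrite mulr_ge0.
    have mu2 : measurable_fun setT (fun x => 2 * upper_part A (t k) (f x)).
      exact: measurable_funM.
    rewrite -[(C%:E * _)%E]ge0_integralZl_EFin ?(ltW C0)//.
    - rewrite -ge0_integralZl_EFin//.
      + by move=> x _; rewrite mule_ge0 ?lee_fin ?(ltW C0).
      + apply: emeasurable_funM => //; exact/measurable_EFinP.
    - by move=> x _; rewrite lee_fin.
    - exact/measurable_EFinP.
  rewrite I1 I2.
  by rewrite lee_wpmul2l// lee_fin.
rewrite -ge0_integral_sum//; last by move=> k x _; rewrite lee_fin.
have mfp : measurable_fun setT (fun x => ((f x) `^ p)%:E).
  by apply/measurable_EFinP; exact: (measurableT_comp (measurable_powR p)).
rewrite -ge0_integralZl_EFin//; first last.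
- by rewrite mulr_ge0 ?powR_ge0// mulr_ge0 ?(ltW C0)// mulr_ge0// mulr_ge0// powR_ge0.
- by move=> x _; rewrite lee_fin powR_ge0.
apply: ge0_le_integral_nonmeasurable => x.
  by rewrite sumEFin lee_fin sumr_ge0.
rewrite sumEFin -EFinM lee_fin.
under eq_bigr do rewrite wE.
have -> : \sum_(0 <= k < n) 2 `^ p * t k `^ p * (C * (2 * upper_part A (t k) (f x))) =
    2 `^ p * C * 2 * \sum_(0 <= k < n) t k `^ p * upper_part A (t k) (f x).
  by rewrite mulr_sumr; apply: eq_bigr => k _; ring.
have := sum_upper_part_le _ A p c S s (f x) n Am A0 (ltW p0) c1 s0 (f0 x) AS.
rewrite powRM// => h.
have -> : D * f x `^ p = 2 `^ p * C * 2 * (2 `^ p * f x `^ p * S) by rewrite /D; ring.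
by rewrite ler_wpM2l// !mulr_ge0 ?powR_ge0// ltW.
Qed.

(** * The B_p condition as a dyadic sum *)

Definition dyadic_itv (R : realType) (c : R) (j : nat) : set R :=
  [set` `[c * 2 ^+ j, c * 2 ^+ j.+1[%R].

Lemma trivIset_dyadic_itv (R : realType) (c : R) (D : set nat) : 0 < c ->
  trivIset D (dyadic_itv R c).
Proof.
move=> c0.
have lt_i i j x : dyadic_itv R c i x -> dyadic_itv R c j x -> (i <= j)%N.
  rewrite /dyadic_itv /= !in_itv/= => /andP[ix _] /andP[_ xj].
  have := le_lt_trans ix xj; rewrite ltr_pM2l// => ij.
  rewrite -ltnS ltnNge; apply/negP => ji; move: ij; apply/negP; rewrite -leNgt.
  by rewrite ler_weXn2l// ler1n.
move=> i j _ _ [x [ix jx]]; apply/eqP; rewrite eqn_leq.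
by rewrite (lt_i _ _ x ix jx) (lt_i _ _ x jx ix).
Qed.

Lemma bigcup_dyadic_itv (R : realType) (c : R) : 0 < c ->
  \bigcup_j dyadic_itv R c j = [set` `[c, +oo[%R].
Proof.
move=> c0; apply/seteqP; split => [x [j _]|x].
  rewrite /dyadic_itv /= !in_itv/= andbT => /andP[+ _]; apply: le_trans.
  by rewrite ler_peMr ?(ltW c0)// exprn_ege1// ler1n.
rewrite /= in_itv/= andbT => cx.
have exm : exists m, x < c * 2 ^+ m.
  have [m xm] := exists_le_expr2 _ (x / c); exists m.+1.
  rewrite mulrC -ltr_pdivrMr// (le_lt_trans xm)// exprS.
  by rewrite ltr_pMl ?exprn_gt0// ltr1n.
have [m xm minm] := ex_minnP exm.
case: m => [|m] in xm minm; first by move: xm; rewrite expr0 mulr1 ltNge cx.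
exists m => //; rewrite /dyadic_itv /= in_itv/= xm andbT leNgt.
by apply/negP => /minm; rewrite ltnn.
Qed.

Lemma measurable_Bp_integrand (R : realType) (A : R -> R) (p c : R) :
  {within [set` `[0, +oo[%R], continuous A} -> 0 < c ->
  measurable_fun [set` `[c, +oo[%R] (fun t => (A t / t `^ p / t)%:E).
Proof.
move=> cA c0; apply/measurable_EFinP.
apply: (eq_measurable_fun (fun t => A t * t `^ (- p) * t `^ (- 1))).
  move=> t /set_mem; rewrite /= in_itv/= andbT => ct.
  by rewrite !powRN powRr1// (le_trans (ltW c0)).
apply: measurable_funM; last exact: measurable_funTS (measurable_powR _).
apply: measurable_funM; last exact: measurable_funTS (measurable_powR _).
apply: (@measurable_funS _ _ R R [set` `[0, +oo[%R]) => //.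
  by move=> t /=; rewrite !in_itv/= !andbT; apply: le_trans; exact: ltW.
exact: subspace_continuous_measurable_fun.
Qed.

Lemma ler_pdiv (R : realFieldType) (x y u v : R) :
  0 <= x -> x <= y -> 0 < v -> v <= u -> x / u <= y / v.
Proof.
move=> x0 xy v0 vu; have u0 := lt_le_trans v0 vu.
by apply: ler_pM => //; rewrite ?invr_ge0 ?(ltW u0)// lef_pV2.
Qed.

(** With [a = c * 2 ^+ j], the integrand on [[a, 2a[] is bounded by taking numerator and
    denominators at opposite endpoints; the interval has length [a]. The lower bound involves [A a],
    the upper one [A (2 * a)], which shifts its index to [j.+1]. *)
Lemma Bp_integral_dyadic (R : realType) (A : R -> R) (p c : R) (j : nat) :
  {within [set` `[0, +oo[%R], continuous A} ->
  (forall u v, 0 <= u -> u <= v -> A u <= A v) ->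
  (forall v, 0 <= v -> 0 <= A v) -> 0 <= p -> 0 < c ->
  let J := (\int[@lebesgue_measure R]_(t in dyadic_itv R c j)
    (A t / t `^ p / t)%:E)%E in
  ((A (c * 2 ^+ j) / (2 ^+ j) `^ p / (2 * (2 * c) `^ p))%:E <= J)%E /\
  (J <= (A (c * 2 ^+ j.+1) / (2 ^+ j.+1) `^ p * (2 `^ p / c `^ p))%:E)%E.
Proof.
move=> cA Am A0 p0 c0 J.
set a := c * 2 ^+ j.
have a0 : 0 < a by rewrite mulr_gt0 ?exprn_gt0.
have aE : c * 2 ^+ j.+1 = 2 * a by rewrite exprS mulrCA.
have IE : dyadic_itv R c j = [set` `[a, 2 * a[%R] by rewrite /dyadic_itv aE.
have mI : measurable [set` `[a, 2 * a[%R] by exact: measurable_itv.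
have len r : (\int[@lebesgue_measure R]_(t in [set` `[a, (2 * a)%R[]) (cst r%:E t) =
    (r * a)%:E)%E.
  rewrite integral_cst//= lebesgue_measure_itv/= lte_fin ifT; last by lra.
  by rewrite -EFinD -EFinM; congr (_%:E); ring.
have mF : measurable_fun [set` `[a, 2 * a[%R] (fun t => (A t / t `^ p / t)%:E).
  apply: (measurable_funS _ _ (measurable_Bp_integrand _ A p a cA a0)) => //.
  by move=> t /=; rewrite !in_itv/= andbT => /andP[].
have F0 t : [set` `[a, 2 * a[%R] t -> (0 <= (A t / t `^ p / t)%:E)%E.
  rewrite /= in_itv/= => /andP[at_ _]; have t0 := le_trans (ltW a0) at_.
  by rewrite lee_fin !divr_ge0 ?powR_ge0// A0.
have cp0 : 0 < c `^ p by exact: powR_gt0.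
have p20 : 0 < (2 : R) `^ p by exact: powR_gt0.
have jp0 : 0 < (2 ^+ j : R) `^ p by rewrite powR_gt0// exprn_gt0.
have apE : a `^ p = c `^ p * (2 ^+ j) `^ p.
  by rewrite powRM ?(ltW c0)// exprn_ge0.
have a2pE : (2 * a) `^ p = 2 `^ p * (c `^ p * (2 ^+ j) `^ p).
  by rewrite powRM ?(ltW a0)// apE.
rewrite /J IE aE; split.
- have -> : A a / (2 ^+ j) `^ p / (2 * (2 * c) `^ p) = A a / (2 * a) `^ p / (2 * a) * a.
    rewrite a2pE [(2 * c) `^ p]powRM ?(ltW c0)//; field.
    by rewrite !gt_eqF.
  rewrite -len; apply: ge0_le_integral => //.
    by move=> t _; rewrite lee_fin !divr_ge0 ?powR_ge0 ?A0 ?ltW// mulr_gt0.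
  move=> t; rewrite /= in_itv/= => /andP[at_ ta]; rewrite lee_fin.
  have t0 : 0 < t := lt_le_trans a0 at_.
  have tp : t `^ p <= (2 * a) `^ p by rewrite ge0_ler_powR ?nnegrE ?(ltW t0) ?(ltW ta)// mulr_ge0// ltW.
  apply: ler_pdiv => //; last exact: ltW.
    by rewrite divr_ge0 ?powR_ge0 ?A0 ?ltW.
  apply: ler_pdiv => //; [|exact/Am/at_/ltW|exact: powR_gt0].
  exact/A0/ltW.
- have -> : A (2 * a) / (2 ^+ j.+1) `^ p * (2 `^ p / c `^ p) = A (2 * a) / a `^ p / a * a.
    rewrite apE exprS powRM ?exprn_ge0//; field.
    by rewrite !gt_eqF.
  rewrite -len; apply: ge0_le_integral => //.
  move=> t; rewrite /= in_itv/= => /andP[at_ ta]; rewrite lee_fin.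
  have t0 : 0 < t := lt_le_trans a0 at_.
  have tp : a `^ p <= t `^ p by rewrite ge0_ler_powR ?nnegrE ?(ltW t0) ?(ltW a0).
  apply: ler_pdiv => //.
    by rewrite divr_ge0 ?powR_ge0 ?A0 ?ltW.
  apply: ler_pdiv => //; [exact/A0/ltW|exact/Am/ltW/ta/ltW|exact: powR_gt0].
Qed.

Lemma in_Bp_dyadic_sum (R : realType) (A : R -> R) (p : R) :
  {within [set` `[0, +oo[%R], continuous A} ->
  (forall u v, 0 <= u -> u <= v -> A u <= A v) ->
  (forall v, 0 <= v -> 0 <= A v) -> 0 <= p -> in_Bp A p ->
  exists c S : R, 1 <= c /\
    forall m, \sum_(0 <= j < m) A (c * 2 ^+ j) / (2 ^+ j) `^ p <= S.
Proof.
move=> cA Am A0 p0 [c' c'0 hI].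
(* Raising [c'] only shrinks the domain of integration, and [1 <= c] is required by
   [sum_upper_part_le]. *)
pose c := Num.max c' 1.
have c1 : 1 <= c by rewrite le_max lexx orbT.
have c0 : 0 < c by lra.
pose F t := (A t / t `^ p / t)%:E.
have mF := measurable_Bp_integrand _ A p _ cA c'0.
have F0 t : 0 <= t -> (0 <= F t)%E.
  by move=> t0; rewrite lee_fin !divr_ge0 ?powR_ge0// A0.
have cc' : [set` `[c, +oo[%R] `<=` [set` `[c', +oo[%R].
  by move=> t /=; rewrite !in_itv/= !andbT; apply: le_trans; rewrite le_max lexx.
have [I IE] : exists I, (\int[@lebesgue_measure R]_(t in [set` `[c', +oo[%R]) F t = I%:E)%E.
  have : (0 <= \int[@lebesgue_measure R]_(t in [set` `[c', +oo[%R]) F t)%E.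
    apply: integral_ge0 => t /=; rewrite in_itv/= andbT => ct.
    by apply: F0; rewrite (le_trans (ltW c'0)).
  move: hI; rewrite -/F; case: (integral _ _ _) => [I _ _|//|//].
  by exists I.
pose k := 2 * (2 * c) `^ p.
have k0 : 0 < k by rewrite mulr_gt0// powR_gt0// mulr_gt0.
exists c, (I * k); split => // m.
rewrite -ler_pdivrMr// -lee_fin -IE mulr_suml -sumEFin.
have sub : \big[setU/set0]_(0 <= j < m) dyadic_itv R c j `<=` [set` `[c', +oo[%R].
  apply: subset_trans cc'; rewrite -bigcup_dyadic_itv//.
  by move=> t; rewrite -bigcup_seq => -[j _ jt]; exists j.
apply: (@le_trans _ _ (\sum_(0 <= j < m)
    \int[@lebesgue_measure R]_(t in dyadic_itv R c j) F t)%E).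
  by apply: lee_sum => j _; case: (Bp_integral_dyadic _ A p c j cA Am A0 p0 c0).
rewrite -ge0_integral_bigsetU//; first last.
- by move=> t /sub /=; rewrite in_itv/= andbT => ct; apply: F0; rewrite (le_trans (ltW c'0)).
- exact: measurable_funS mF.
- exact: trivIset_dyadic_itv.
- exact: iota_uniq.
- by move=> j; exact: measurable_itv.
apply: ge0_subset_integral => //.
- by apply: bigsetU_measurable => j _; exact: measurable_itv.
- by move=> t /=; rewrite in_itv/= andbT => ct; apply: F0; rewrite (le_trans (ltW c'0)).
Qed.

Lemma dyadic_sum_in_Bp (R : realType) (A : R -> R) (p c S : R) :
  {within [set` `[0, +oo[%R], continuous A} ->
  (forall u v, 0 <= u -> u <= v -> A u <= A v) ->
  (forall v, 0 <= v -> 0 <= A v) -> 0 <= p -> 0 < c ->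
  (forall m, \sum_(0 <= j < m) A (c * 2 ^+ j) / (2 ^+ j) `^ p <= S) ->
  in_Bp A p.
Proof.
move=> cA Am A0 p0 c0 AS; exists c => //.
pose F t := (A t / t `^ p / t)%:E.
have F0 t : [set` `[c, +oo[%R] t -> (0 <= F t)%E.
  rewrite /= in_itv/= andbT => ct; have t0 : 0 <= t by rewrite (le_trans (ltW c0)).
  by rewrite lee_fin !divr_ge0 ?powR_ge0// A0.
have k0 : 0 <= 2 `^ p / c `^ p by rewrite divr_ge0 ?powR_ge0.
have IE := bigcup_dyadic_itv R c c0.
rewrite -IE ge0_integral_bigcup//; first last.
- exact: trivIset_dyadic_itv.
- by move=> t; rewrite IE; exact: F0.
- by rewrite IE; exact: measurable_Bp_integrand.
- by move=> j; exact: measurable_itv.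
apply: (@le_lt_trans _ _ (S * (2 `^ p / c `^ p))%:E); last by rewrite ltry.
apply: lime_le.
  apply: is_cvg_nneseries => j _ _; apply: integral_ge0 => t jt.
  by apply: F0; rewrite -IE; exists j.
apply: nearW => m.
apply: (@le_trans _ _ (\sum_(0 <= j < m)
    (A (c * 2 ^+ j.+1) / (2 ^+ j.+1) `^ p * (2 `^ p / c `^ p))%:E)%E).
  by apply: lee_sum => j _; case: (Bp_integral_dyadic _ A p c j cA Am A0 p0 c0).
(* The [m] upper bounds carry the indices [j.+1]: they form the partial sum of [m.+1] terms without
   its nonnegative first term. *)
rewrite sumEFin lee_fin -mulr_suml ler_wpM2r// (le_trans _ (AS m.+1))//.
rewrite big_nat_recl// lerDr divr_ge0 ?powR_ge0// A0//.
by rewrite mulr_ge0 ?exprn_ge0// ltW.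
Qed.

(** * Necessity: testing on the indicator of a ball *)

(** A geometric sum of ratio at most 1/2 is at most twice its largest selected term. This turns
    bounds at each scale separately into a bound on the sum over all scales, although the balls
    involved are concentric and overlap. *)
Lemma sum_lacunary_le (R : realFieldType) (q y : R) (b : nat -> bool) (n : nat) :
  0 < q -> q <= 2^-1 -> 0 <= y -> (forall j, b j -> q ^+ j <= y) ->
  \sum_(0 <= j < n) q ^+ j * (b j)%:R <= 2 * y.
Proof.
move=> q0 q2; elim: n b y => [|n ih] b y y0 by_; first by rewrite big_nil mulr_ge0.
rewrite big_nat_recl//= expr0 mul1r.
have -> : \sum_(0 <= i < n) q ^+ i.+1 * (b i.+1)%:R =
          q * \sum_(0 <= i < n) q ^+ i * (b i.+1)%:R.
  by rewrite mulr_sumr; apply: eq_bigr => i _; rewrite exprS mulrA.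
(* Induction bounds the shifted tail with 1 in place of [y] if [b 0] holds, and with [y / q]
   otherwise. *)
have [b0|nb0] := boolP (b 0%N).
  have y1 : 1 <= y by have := by_ _ b0.
  have : \sum_(0 <= i < n) q ^+ i * (b i.+1)%:R <= 2 * 1.
    apply: ih => // j _; rewrite exprn_ile1 ?(ltW q0)//.
    by rewrite (le_trans q2)// invf_le1// ler1n.
  by move=> h; have := ler_wpM2l (ltW q0) h; rewrite /=; lra.
have : \sum_(0 <= i < n) q ^+ i * (b i.+1)%:R <= 2 * (y / q).
  apply: ih => [|j bj]; first by rewrite divr_ge0// ltW.
  by rewrite ler_pdivlMr// -exprSr by_.
move=> /(ler_wpM2l (ltW q0)); rewrite add0r => /le_trans; apply.
suff -> : q * (2 * (y / q)) = 2 * y by [].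
by field; rewrite gt_eqF.
Qed.

(** For [l' < l] the average of [A (\1_B0 / l')] over [B] is at least [A l^-1 * mu B0 / mu B], which
    exceeds 1, so no such [l'] is admissible. *)
Lemma orlicz_norm_indic_ge (R : realType) (d : measure_display)
    (X : measurableType d) (mu : {measure set X -> \bar R}) (A : R -> R)
    (B0 B : set X) (l : R) :
  {within [set` `[0, +oo[%R], continuous A} ->
  (forall u v, 0 <= u -> u <= v -> A u <= A v) ->
  (forall v, 0 <= v -> 0 <= A v) -> measurable B0 -> measurable B ->
  B0 `<=` B -> (0 < mu B < +oo)%E -> 0 < l ->
  (mu B < (A l^-1)%:E * mu B0)%E ->
  (l%:E <= orlicz_norm mu A B \1_B0)%E.
Proof.
move=> cA Am A0 mB0 mB B0B /andP[muB0 muBoo] l0 muB.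
apply: le_ereal_inf_tmp => _ [l' [l'0 adm] <-]; rewrite lee_fin leNgt.
apply/negP => l'l; move: adm; apply/negP; rewrite -ltNge.
have [m mE] : exists m, mu B = m%:E.
  by exists (fine (mu B)); rewrite fineK// gt0_fin_numE.
have m0 : 0 < m by rewrite -lte_fin -mE.
rewrite mE inver gt_eqF// lte_pdivlMl// mule1 -mE.
apply: lt_le_trans muB _.
have -> : mu B0 = (\int[mu]_(x in B) (\1_B0 x)%:E)%E.
  by rewrite integral_indic// setIidl.
have Al0 : 0 <= A l^-1 by rewrite A0// invr_ge0 ltW.
rewrite -ge0_integralZl_EFin//; last exact/measurable_EFinP.
apply: ge0_le_integral => //.
- by move=> x _; rewrite mule_ge0 ?lee_fin.
- by apply: emeasurable_funM => //; exact/measurable_EFinP.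
- apply/measurable_EFinP; apply: measurable_funTS.
  apply: measurable_comp_young => //.
    by apply: measurable_funM => //; apply: measurableT_comp.
  by move=> x; rewrite divr_ge0// ltW.
move=> x _; rewrite -EFinM lee_fin indicE; case: (x \in B0).
  rewrite normr1 mulr1 div1r; apply: Am; first by rewrite invr_ge0 ltW.
  by rewrite lef_pV2 ?posrE// ltW.
by rewrite mulr0 A0// divr_ge0// ltW.
Qed.

Lemma orlicz_maximal_Lp_dyadic_sum (R : realType) (d : measure_display)
    (X : measurableType d) (rho : X -> X -> R)
    (mu : {measure set X -> \bar R}) (Cd p C : R) (A : R -> R) :
  homogeneous_type rho mu Cd -> mu setT = +oo%E -> 1 <= p ->
  young_function A -> (forall v, 1 <= v -> v <= A v) ->
  (forall f : X -> R, measurable_fun setT f -> (forall x, 0 <= f x) ->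
      (\int[mu]_x (`|orlicz_maximal rho mu A f x| `^ p) <=
       C%:E * \int[mu]_x ((f x) `^ p)%:E)%E) ->
  exists S : R, forall m, \sum_(0 <= j < m) A (2 * 2 ^+ j) / (2 ^+ j) `^ p <= S.
Proof.
move=> hX muX p1 [_ Am cA A0 _] A1 bdd; have [qm mB dbl] := hX.
have /set0P[x0 _] : [set: X] != set0.
  by apply/eqP => X0; move: muX; rewrite X0 measure0.
have C0 := doubling_const_gt0 _ _ _ _ _ _ x0 dbl.
have p0 : 0 < p by lra.
pose B i := qball rho x0 (2 ^+ i).
have r0 i : 0 < 2 ^+ i :> R by rewrite exprn_gt0.
pose m i := fine (mu (B i)).
have mE i : mu (B i) = (m i)%:E.
  have /andP[? ?] := doubling_qball_gt0_fin _ _ _ _ _ _ x0 _ dbl (r0 i).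
  by rewrite fineK// gt0_fin_numE.
have m0 i : 0 < m i.
  have /andP[+ _] := doubling_qball_gt0_fin _ _ _ _ _ _ x0 _ dbl (r0 i).
  by rewrite -/(B i) mE.
have a1 j : 1 < A (2 * 2 ^+ j).
  have e1 : (1 : R) <= 2 ^+ j by rewrite exprn_ege1// ler1n.
  by apply: (@lt_le_trans _ _ (2 * 2 ^+ j)); [lra|apply: A1; lra].
(* [g j] is the index just before the first dyadic ball of measure at least [m 0 * A (2 * 2 ^+ j)].
   Such a ball exists as [mu setT = +oo], its index is positive by [a1], and one doubling step back
   costs [Cd]. *)
have /choice[g gP] j : exists i, m i < m 0 * A (2 * 2 ^+ j) <= Cd * m i.
  have exi : exists i, m 0 * A (2 * 2 ^+ j) <= m i.
    have [n nP] := qball_measure_unbounded _ _ _ rho mu x0 (m 0 * A (2 * 2 ^+ j)) mB muX.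
    have [i ni] := exists_le_expr2 _ (n%:R : R).
    exists i; rewrite -lee_fin -mE (le_trans (ltW nP))//.
    by apply: le_measure; [exact/mem_set/mB|exact/mem_set/mB|exact: qball_le].
  have [i ai mini] := ex_minnP exi; case: i => [|i] in ai mini.
    by move: ai; rewrite leNgt ltr_pMr// a1.
  exists i; apply/andP; split; first by rewrite ltNge; apply/negP => /mini; rewrite ltnn.
  rewrite (le_trans ai)// -lee_fin EFinM -!mE.
  by have [_ + _] := dbl x0 _ (r0 i); rewrite -exprS.
pose f : X -> R := \1_(B 0%N).
have mf : measurable_fun setT f by apply: measurable_indic; exact: mB.
have f0 x : 0 <= f x by rewrite /f.
have lf j x : B (g j) x ->
    ((2 * 2 ^+ j)^-1%:E <= orlicz_maximal rho mu A f x)%E.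
  move=> Bx; apply: (@le_trans _ _ (orlicz_norm mu A (B (g j)) f)); last first.
    by apply: ereal_sup_ubound; exists (x0, 2 ^+ g j) => //; split => //; exact: r0.
  apply: orlicz_norm_indic_ge => //; [exact: mB|exact: mB| | |].
  - by apply: qball_le; rewrite expr0 exprn_ege1// ler1n.
  - exact: (doubling_qball_gt0_fin _ _ _ _ _ _ _ _ dbl).
  by rewrite invrK !mE -EFinM lte_fin mulrC; case/andP: (gP j).
pose q : R := 2^-1 `^ p.
have q0 : 0 < q by rewrite powR_gt0// invr_gt0.
have q2 : q <= 2^-1.
  by apply: ge1r_powR => //; rewrite invr_gt0// ltr0n/= invf_le1// ler1n.
have qE j : q ^+ j = (2 ^- j) `^ p.
  by rewrite -powR_mulrn ?(ltW q0)// -powRrM mulrC powRrM powR_mulrn ?exprVn.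
(* On [B (g j)] the [p]-th power of the maximal function is at least [q ^+ j.+1]; the lacunary
   bound, applied with [y / q] because of the shifted exponent, gives the factor [q / 2]. *)
have ptw n x : ((q / 2 * \sum_(0 <= j < n) q ^+ j * \1_(B (g j)) x)%:E <=
    `|orlicz_maximal rho mu A f x| `^ p)%E.
  have M0 := orlicz_maximal_ge0 _ _ _ _ mu A f x qm.
  rewrite gee0_abs//.
  have lf' j : B (g j) x ->
      ((q ^+ j.+1)%:E <= orlicz_maximal rho mu A f x `^ p)%E.
    move=> /lf h; rewrite qE -poweR_EFin; apply: gt0_ler_poweR => //.
    - exact: ltW.
    - by rewrite in_itv/= leey andbT lee_fin invr_ge0 exprn_ge0.
    - by rewrite in_itv/= leey andbT.
    - by rewrite exprS.
  move: lf' (poweR_ge0 (orlicz_maximal rho mu A f x) p).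
  case: (orlicz_maximal rho mu A f x `^ p)%E => [y lf' y0|_ _|//]; last by rewrite leey.
  rewrite lee_fin in y0.
  have := sum_lacunary_le _ q (y / q) (fun j => x \in B (g j)) n q0 q2.
  rewrite divr_ge0 ?(ltW q0)// => /(_ isT) h.
  have {}h : \sum_(0 <= j < n) q ^+ j * \1_(B (g j)) x <= 2 * (y / q).
    apply: h => j /set_mem/lf'; rewrite lee_fin ler_pdivlMr// => h.
    by rewrite -exprSr.
  have yE : y = q / 2 * (2 * (y / q)) by field; rewrite gt_eqF.
  by rewrite lee_fin [leRHS]yE ler_wpM2l// divr_ge0// ltW.
have If : (\int[mu]_x ((f x) `^ p)%:E = (m 0)%:E)%E.
  rewrite -mE -[B 0%N in RHS]setIT -integral_indic//; last exact: mB.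
  apply: eq_integral => x _; rewrite /f indicE; case: (_ \in _); rewrite ?powR1//.
  by rewrite powR0// gt_eqF.
(* [q / 2] comes from [ptw], [Cd] from the choice of [g] and [C] from boundedness; [m 0] appears on
   both sides and cancels. *)
exists (2 * C * Cd / q) => n.
have mI j : measurable_fun setT (fun x => (q / 2 * (q ^+ j * \1_(B (g j)) x))%:E).
  apply/measurable_EFinP; do 2 apply: measurable_funM => //.
  by apply: measurable_indic; exact: mB.
have I0 j x : 0 <= q / 2 * (q ^+ j * \1_(B (g j)) x).
  by rewrite !mulr_ge0 ?exprn_ge0 ?(ltW q0).
have : (\sum_(0 <= j < n) (q / 2 * q ^+ j * m (g j))%:E <= (C * m 0)%:E)%E.
  apply: (@le_trans _ _ (\int[mu]_x
      (q / 2 * \sum_(0 <= j < n) q ^+ j * \1_(B (g j)) x)%:E)%E); last first.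
    rewrite EFinM -If; apply: le_trans (bdd f mf f0).
    apply: ge0_le_integral_nonmeasurable => // x.
    by rewrite lee_fin mulr_sumr sumr_ge0.
  have -> : (\int[mu]_x (q / 2 * \sum_(0 <= j < n) q ^+ j * \1_(B (g j)) x)%:E =
      \int[mu]_x \sum_(0 <= j < n) (q / 2 * (q ^+ j * \1_(B (g j)) x))%:E)%E.
    by apply: eq_integral => x _; rewrite mulr_sumr -sumEFin.
  rewrite (@ge0_integral_sum _ _ _ mu _ measurableT _
    (fun j x => (q / 2 * (q ^+ j * \1_(B (g j)) x))%:E))//; last first.
    by move=> j x _; rewrite lee_fin.
  apply: lee_sum => j _.
  have -> : (\int[mu]_x (q / 2 * (q ^+ j * \1_(B (g j)) x))%:E =
             (q / 2 * q ^+ j)%:E * \int[mu]_x (\1_(B (g j)) x)%:E)%E.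
    rewrite -ge0_integralZl_EFin//.
    - by apply: eq_integral => x _; rewrite -EFinM mulrA.
    - by apply/measurable_EFinP; apply: measurable_indic; exact: mB.
    - by rewrite !mulr_ge0 ?exprn_ge0 ?(ltW q0).
  by rewrite integral_indic ?setIT ?mE ?EFinM//; exact: mB.
rewrite sumEFin lee_fin => h.
have k0 : 0 < q / 2 / Cd * m 0 by rewrite mulr_gt0// !divr_gt0.
have h2 : q / 2 / Cd * m 0 * (\sum_(0 <= j < n) A (2 * 2 ^+ j) / (2 ^+ j) `^ p) <= C * m 0.
  apply: le_trans h; rewrite mulr_sumr; apply: ler_sum => j _.
  have -> : A (2 * 2 ^+ j) / (2 ^+ j) `^ p = A (2 * 2 ^+ j) * q ^+ j.
    by rewrite qE -powR_inv1 ?powR_ge0// powRAC powR_inv1 ?exprn_ge0.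
  have /andP[_ gj] := gP j.
  have -> : q / 2 / Cd * m 0 * (A (2 * 2 ^+ j) * q ^+ j) =
      q / 2 * q ^+ j * (m 0 * A (2 * 2 ^+ j) / Cd) by field; rewrite gt_eqF.
  rewrite ler_wpM2l ?ler_pdivrMr ?[m _ * Cd]mulrC//.
  by rewrite !mulr_ge0 ?exprn_ge0 ?(ltW q0).
rewrite -(ler_pM2l k0) (le_trans h2)//.
have -> : q / 2 / Cd * m 0 * (2 * C * Cd / q) = C * m 0.
  by field; rewrite !gt_eqF.
by [].
Qed.

Theorem theorem3p4 (R : realType) (d : measure_display) (X : measurableType d)
    (rho : X -> X -> R) (mu : {measure set X -> \bar R}) (Cd : R)
    (hX : homogeneous_type rho mu Cd) (muX : mu setT = +oo%E)
    (p : R) (p1 : 1 < p)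
    (A : R -> R) (hA : young_function A)
    (A_incr : forall s t : R, 0 < s -> s <= t -> A s / s <= A t / t)
    (A_infty : A t @[t --> +oo] --> +oo)
    (A1 : A 1 = 1) :
  bounded_on_Lp mu p (orlicz_maximal rho mu A) <-> in_Bp A p.
Proof.
have [_ Am cA A0 _] := hA.
have p0 : 0 < p by lra.
split => [/(bounded_on_Lp_integral _ _ _ _ _ _ p0)[C _ bdd]|Bp].
(* [A t / t] is increasing with value 1 at [t = 1]: it is at least 1 to the right, and, for [A2]
   below, at most 1 to the left. *)
- have A_ge v : 1 <= v -> v <= A v.
    move=> v1; have v0 : 0 < v by lra.
    by have := A_incr _ _ ltr01 v1; rewrite A1 divr1 ler_pdivlMr// mul1r.
  have [S AS] := orlicz_maximal_Lp_dyadic_sum _ _ _ _ _ _ _ _ _ hX muX (ltW p1) hA A_ge bdd.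
  exact: (dyadic_sum_in_Bp _ _ _ _ _ cA Am A0 (ltW p0) (ltr0Sn R 1) AS).
- have [c [S [c1 AS]]] := in_Bp_dyadic_sum _ _ _ cA Am A0 (ltW p0) Bp.
  have A2 : A 2^-1 <= 2^-1.
    have h2 : (0 : R) < 2^-1 by rewrite invr_gt0.
    have h1 : (2^-1 : R) <= 1 by rewrite invf_le1// ler1n.
    by have := A_incr _ _ h2 h1; rewrite A1 divr1 ler_pdivrMr// mul1r.
  apply/(bounded_on_Lp_integral _ _ _ _ _ _ p0).
  exact: orlicz_maximal_Lp_bound hX muX (ltW p1) hA A2 c1 AS.
Qed.
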